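(* For every set of formulas $\Gamma\cup\{A\}\subseteq For(\Sigma)$: $\Gamma\vdash_{LET_K^+}A$ if and only if $\Gamma\models^2_{LET_K^+}A$.
   Context: $For(\Sigma)$ is the set of formulas over a denumerable set of propositional variables and $\Sigma=\{\land,\lor,\to,\neg,\circ\}$. The logic $LET_K$ is the natural deduction system with rules: ($\land$I) from $A,B$ infer $A\land B$; ($\land$E) from $A\land B$ infer $A$ and $B$; ($\lor$I) from $A$ (or from $B$) infer $A\lor B$; ($\lor$E) from $A\lor B$ and derivations of $C$ from $[A]$ and from $[B]$ infer $C$; ($\neg\land$I) from $\neg A$ (or $\neg B$) infer $\neg(A\land B)$; ($\neg\land$E) from $\neg(A\land B)$ and derivations of $C$ from $[\neg A]$ and from $[\neg B]$ infer $C$; ($\neg\lor$I) from $\neg A,\neg B$ infer $\neg(A\lor B)$; ($\neg\lor$E) from $\neg(A\lor B)$ infer $\neg A$ and $\neg B$; (DN) $A$ and $\neg\neg A$ are inter-derivable; ($\to$I) from a derivation of $B$ from $[A]$ infer $A\to B$; ($\to$E) from $A\to B$ and $A$ infer $B$; ($\to_{CL}$) axiom $A\lor(A\to B)$; ($\neg\to$I) from $A,\neg B$ infer $\neg(A\to B)$; ($\neg\to$E) from $\neg(A\to B)$ infer $A$ and $\neg B$; (EXP$^\circ$) from $\circ A,A,\neg A$ infer $B$; (PEM$^\circ$) from $\circ A$ infer $A\lor\neg A$ (bracketed hypotheses are discharged). Write $A^T$ for $\circ A\land A$ and $A^F$ for $\circ A\land\neg A$. $LET_K^+$ adds: (I$\circ$)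 axiom $\circ\circ A$; (I$\neg\circ$) from $\circ A$ infer $\circ\neg A$; (E$\neg\circ$) from $\circ\neg A$ infer $\circ A$; (I$\land$T) from $A^T,B^T$ infer $(A\land B)^T$; (I$\land$F) from $A^F$ (or $B^F$) infer $(A\land B)^F$; (I$\lor$T) from $A^T$ (or $B^T$) infer $(A\lor B)^T$; (I$\lor$F) from $A^F,B^F$ infer $(A\lor B)^F$; (I$\to$T) from $A^F$ (or $B^T$) infer $(A\to B)^T$; (I$\to$F) from $A,B^F$ infer $(A\to B)^F$; (E$\land$T) from $(A\land B)^T$ infer $A^T$ and $B^T$; (E$\land$F) from $(A\land B)^F$ and derivations of $C$ from $[A^F]$ and from $[B^F]$ infer $C$; (E$\lor$T) from $(A\lor B)^T$ and derivations of $C$ from $[A^T]$ and from $[B^T]$ infer $C$; (E$\lor$F) from $(A\lor B)^F$ infer $A^F$ and $B^F$; (E$\to$T) from $(A\to B)^T$ and derivations of $C$ from $[A^F]$ and from $[B^T]$ infer $C$; (E$\to$F) from $(A\to B)^F$ infer $A$ and $B^F$. A bivaluation for $LET_K$ is $\rho:For(\Sigma)\to\{0,1\}$ with: (v1) $\rho(A\land B)=1$ iff $\rho(A)=\rho(B)=1$; (v2) $\rho(A\lor B)=1$ iff $\rho(A)=1$ or $\rho(B)=1$; (v3) $\rho(A\to B)=1$ iff $\rho(A)=0$ or $\rho(B)=1$; (v4) $\rho(\neg\neg A)=1$ iff $\rho(A)=1$; (v5) $\rho(\neg(A\land B))=1$ iff $\rho(\neg A)=1$ or $\rho(\neg B)=1$;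 (v6) $\rho(\neg(A\lor B))=1$ iff $\rho(\neg A)=\rho(\neg B)=1$; (v7) $\rho(\neg(A\to B))=1$ iff $\rho(A)=\rho(\neg B)=1$; (v8) if $\rho(\circ A)=1$ then ($\rho(\neg A)=1$ iff $\rho(A)=0$). A bivaluation for $LET_K^+$ is a bivaluation for $LET_K$ satisfying moreover, for all $A,B$: (vp1) $\rho(\circ\circ A)=1$; (vp2) $\rho(\circ\neg A)=\rho(\circ A)$; (vp3) if $\rho(\circ A)=\rho(A)=1$ and $\rho(\circ B)=\rho(B)=1$ then $\rho(\circ(A\land B))=1$; (vp4) if $\rho(\circ A)=\rho(\neg A)=1$ then $\rho(\circ(A\land B))=1$; (vp5) if $\rho(\circ B)=\rho(\neg B)=1$ then $\rho(\circ(A\land B))=1$; (vp6) if $\rho(\circ(A\land B))=\rho(A)=\rho(B)=1$ then $\rho(\circ A)=\rho(\circ B)=1$; (vp7) if $\rho(\circ(A\land B))=1$ and ($\rho(\neg A)=1$ or $\rho(\neg B)=1$) then ($\rho(\circ A)=\rho(\neg A)=1$ or $\rho(\circ B)=\rho(\neg B)=1$); (vp8) if $\rho(\circ A)=\rho(A)=1$ then $\rho(\circ(A\lor B))=1$; (vp9) if $\rho(\circ B)=\rho(B)=1$ then $\rho(\circ(A\lor B))=1$; (vp10) if $\rho(\circ A)=\rho(\neg A)=1$ and $\rho(\circ B)=\rho(\neg B)=1$ then $\rho(\circ(A\lor B))=1$; (vp11) if $\rho(\circ(A\lor B))=1$ and ($\rho(A)=1$ or $\rho(B)=1$) then ($\rho(\circ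 A)=\rho(A)=1$ or $\rho(\circ B)=\rho(B)=1$); (vp12) if $\rho(\circ(A\lor B))=1$ and $\rho(A)=\rho(B)=0$ then $\rho(\circ A)=\rho(\circ B)=1$; (vp13) if $\rho(\circ A)=\rho(\neg A)=1$ then $\rho(\circ(A\to B))=1$; (vp14) if $\rho(\circ B)=\rho(B)=1$ then $\rho(\circ(A\to B))=1$; (vp15) if $\rho(A)=1$ and $\rho(\circ B)=\rho(\neg B)=1$ then $\rho(\circ(A\to B))=1$; (vp16) if $\rho(\circ(A\to B))=1$ and ($\rho(A)=0$ or $\rho(B)=1$) then ($\rho(\circ A)=\rho(\neg A)=1$ or $\rho(\circ B)=\rho(B)=1$); (vp17) if $\rho(\circ(A\to B))=1$ and $\rho(A)=\rho(\neg B)=1$ then $\rho(\circ B)=1$. $\Gamma\models^2_{LET_K^+}A$ means: every bivaluation for $LET_K^+$ giving value 1 to all members of $\Gamma$ gives value 1 to $A$. *)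

(* Defs.v *)
From Stdlib Require Import Ensembles.

Inductive form : Type :=
| Var (n : nat)
| And (A B : form)
| Or (A B : form)
| Imp (A B : form)
| Neg (A : form)
| Circ (A : form).

Declare Scope form_scope.
Delimit Scope form_scope with form.
Bind Scope form_scope with form.

Notation "A ∧ B" := (And A B) (at level 80, right associativity) : form_scope.
Notation "A ∨ B" := (Or A B) (at level 85, right associativity) : form_scope.
Notation "A → B" := (Imp A B)
  (at level 99, B at level 200, right associativity) : form_scope.
Notation "¬ A" := (Neg A) (at level 75, right associativity) : form_scope.
Notation "∘ A" := (Circ A) (at level 75, right associativity) : form_scope.

Open Scope form_scope.

(* Written A^T ("A is reliably true") and A^F ("A is reliably false"). *)
Definition isT (A : form) : form := ∘ A ∧ A.
Definition isF (A : form) : form := ∘ A ∧ ¬ A.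

(* The natural deduction system LET_K^+, which includes all the rules of
   LET_K: [LETKp Γ A] holds iff there is a
   (finite) derivation of [A] all of whose undischarged hypotheses are in [Γ].
   [Γ] may be infinite; a subderivation from a discharged hypothesis [[A]]
   is a derivation from [Add form Γ A], i.e. from Γ ∪ {A}. *)
Inductive LETKp (Γ : Ensemble form) : form -> Prop :=
| Hyp A : In form Γ A -> LETKp Γ A
| AndI A B : LETKp Γ A -> LETKp Γ B -> LETKp Γ (A ∧ B)
| AndE1 A B : LETKp Γ (A ∧ B) -> LETKp Γ A
| AndE2 A B : LETKp Γ (A ∧ B) -> LETKp Γ B
| OrI1 A B : LETKp Γ A -> LETKp Γ (A ∨ B)
| OrI2 A B : LETKp Γ B -> LETKp Γ (A ∨ B)
| OrE A B C :
    LETKp Γ (A ∨ B) -> LETKp (Add form Γ A) C -> LETKp (Add form Γ B) C ->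
    LETKp Γ C
| NegAndI1 A B : LETKp Γ (¬ A) -> LETKp Γ (¬ (A ∧ B))
| NegAndI2 A B : LETKp Γ (¬ B) -> LETKp Γ (¬ (A ∧ B))
| NegAndE A B C :
    LETKp Γ (¬ (A ∧ B)) ->
    LETKp (Add form Γ (¬ A)) C -> LETKp (Add form Γ (¬ B)) C ->
    LETKp Γ C
| NegOrI A B : LETKp Γ (¬ A) -> LETKp Γ (¬ B) -> LETKp Γ (¬ (A ∨ B))
| NegOrE1 A B : LETKp Γ (¬ (A ∨ B)) -> LETKp Γ (¬ A)
| NegOrE2 A B : LETKp Γ (¬ (A ∨ B)) -> LETKp Γ (¬ B)
| DNI A : LETKp Γ A -> LETKp Γ (¬ ¬ A)
| DNE A : LETKp Γ (¬ ¬ A) -> LETKp Γ A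
| ImpI A B : LETKp (Add form Γ A) B -> LETKp Γ (A → B)
| ImpE A B : LETKp Γ (A → B) -> LETKp Γ A -> LETKp Γ B
| ImpCL A B : LETKp Γ (A ∨ (A → B))
| NegImpI A B : LETKp Γ A -> LETKp Γ (¬ B) -> LETKp Γ (¬ (A → B))
| NegImpE1 A B : LETKp Γ (¬ (A → B)) -> LETKp Γ A
| NegImpE2 A B : LETKp Γ (¬ (A → B)) -> LETKp Γ (¬ B)
| EXPCirc A B : LETKp Γ (∘ A) -> LETKp Γ A -> LETKp Γ (¬ A) -> LETKp Γ B
| PEMCirc A : LETKp Γ (∘ A) -> LETKp Γ (A ∨ ¬ A)
| ICirc A : LETKp Γ (∘ ∘ A)
| INegCirc A : LETKp Γ (∘ A) -> LETKp Γ (∘ ¬ A)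
| ENegCirc A : LETKp Γ (∘ ¬ A) -> LETKp Γ (∘ A)
| IAndT A B : LETKp Γ (isT A) -> LETKp Γ (isT B) -> LETKp Γ (isT (A ∧ B))
| IAndF1 A B : LETKp Γ (isF A) -> LETKp Γ (isF (A ∧ B))
| IAndF2 A B : LETKp Γ (isF B) -> LETKp Γ (isF (A ∧ B))
| IOrT1 A B : LETKp Γ (isT A) -> LETKp Γ (isT (A ∨ B))
| IOrT2 A B : LETKp Γ (isT B) -> LETKp Γ (isT (A ∨ B))
| IOrF A B : LETKp Γ (isF A) -> LETKp Γ (isF B) -> LETKp Γ (isF (A ∨ B))
| IImpT1 A B : LETKp Γ (isF A) -> LETKp Γ (isT (A → B))
| IImpT2 A B : LETKp Γ (isT B) -> LETKp Γ (isT (A → B))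
| IImpF A B : LETKp Γ A -> LETKp Γ (isF B) -> LETKp Γ (isF (A → B))
| EAndT1 A B : LETKp Γ (isT (A ∧ B)) -> LETKp Γ (isT A)
| EAndT2 A B : LETKp Γ (isT (A ∧ B)) -> LETKp Γ (isT B)
| EAndF A B C :
    LETKp Γ (isF (A ∧ B)) ->
    LETKp (Add form Γ (isF A)) C -> LETKp (Add form Γ (isF B)) C ->
    LETKp Γ C
| EOrT A B C :
    LETKp Γ (isT (A ∨ B)) ->
    LETKp (Add form Γ (isT A)) C -> LETKp (Add form Γ (isT B)) C ->
    LETKp Γ C
| EOrF1 A B : LETKp Γ (isF (A ∨ B)) -> LETKp Γ (isF A)
| EOrF2 A B : LETKp Γ (isF (A ∨ B)) -> LETKp Γ (isF B)
| EImpT A B C :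
    LETKp Γ (isT (A → B)) ->
    LETKp (Add form Γ (isF A)) C -> LETKp (Add form Γ (isT B)) C ->
    LETKp Γ C
| EImpF1 A B : LETKp Γ (isF (A → B)) -> LETKp Γ A
| EImpF2 A B : LETKp Γ (isF (A → B)) -> LETKp Γ (isF B).

Record bivaluation_LETK (ρ : form -> bool) : Prop := {
  v1 : forall A B, ρ (A ∧ B) = true <-> ρ A = true /\ ρ B = true;
  v2 : forall A B, ρ (A ∨ B) = true <-> ρ A = true \/ ρ B = true;
  v3 : forall A B, ρ (A → B) = true <-> ρ A = false \/ ρ B = true;
  v4 : forall A, ρ (¬ ¬ A) = true <-> ρ A = true;
  v5 : forall A B,
    ρ (¬ (A ∧ B)) = true <-> ρ (¬ A) = true \/ ρ (¬ B) = true;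
  v6 : forall A B,
    ρ (¬ (A ∨ B)) = true <-> ρ (¬ A) = true /\ ρ (¬ B) = true;
  v7 : forall A B,
    ρ (¬ (A → B)) = true <-> ρ A = true /\ ρ (¬ B) = true;
  v8 : forall A, ρ (∘ A) = true -> (ρ (¬ A) = true <-> ρ A = false)
}.

Record bivaluation_LETKp (ρ : form -> bool) : Prop := {
  vK : bivaluation_LETK ρ;
  vp1 : forall A, ρ (∘ ∘ A) = true;
  vp2 : forall A, ρ (∘ ¬ A) = ρ (∘ A);
  vp3 : forall A B,
    ρ (∘ A) = true /\ ρ A = true -> ρ (∘ B) = true /\ ρ B = true ->
    ρ (∘ (A ∧ B)) = true;
  vp4 : forall A B,
    ρ (∘ A) = true /\ ρ (¬ A) = true -> ρ (∘ (A ∧ B)) = true;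
  vp5 : forall A B,
    ρ (∘ B) = true /\ ρ (¬ B) = true -> ρ (∘ (A ∧ B)) = true;
  vp6 : forall A B,
    ρ (∘ (A ∧ B)) = true /\ ρ A = true /\ ρ B = true ->
    ρ (∘ A) = true /\ ρ (∘ B) = true;
  vp7 : forall A B,
    ρ (∘ (A ∧ B)) = true -> ρ (¬ A) = true \/ ρ (¬ B) = true ->
    (ρ (∘ A) = true /\ ρ (¬ A) = true) \/ (ρ (∘ B) = true /\ ρ (¬ B) = true);
  vp8 : forall A B,
    ρ (∘ A) = true /\ ρ A = true -> ρ (∘ (A ∨ B)) = true;
  vp9 : forall A B,
    ρ (∘ B) = true /\ ρ B = true -> ρ (∘ (A ∨ B)) = true;
  vp10 : forall A B,
    ρ (∘ A) = true /\ ρ (¬ A) = true -> ρ (∘ B) = true /\ ρ (¬ B) = true ->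
    ρ (∘ (A ∨ B)) = true;
  vp11 : forall A B,
    ρ (∘ (A ∨ B)) = true -> ρ A = true \/ ρ B = true ->
    (ρ (∘ A) = true /\ ρ A = true) \/ (ρ (∘ B) = true /\ ρ B = true);
  vp12 : forall A B,
    ρ (∘ (A ∨ B)) = true -> ρ A = false /\ ρ B = false ->
    ρ (∘ A) = true /\ ρ (∘ B) = true;
  vp13 : forall A B,
    ρ (∘ A) = true /\ ρ (¬ A) = true -> ρ (∘ (A → B)) = true;
  vp14 : forall A B,
    ρ (∘ B) = true /\ ρ B = true -> ρ (∘ (A → B)) = true;
  vp15 : forall A B,
    ρ A = true -> ρ (∘ B) = true /\ ρ (¬ B) = true -> ρ (∘ (A → B)) = true;
  vp16 : forall A B,
    ρ (∘ (A → B)) = true -> ρ A = false \/ ρ B = true ->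
    (ρ (∘ A) = true /\ ρ (¬ A) = true) \/ (ρ (∘ B) = true /\ ρ B = true);
  vp17 : forall A B,
    ρ (∘ (A → B)) = true -> ρ A = true /\ ρ (¬ B) = true -> ρ (∘ B) = true
}.

Definition entails_LETKp (Γ : Ensemble form) (A : form) : Prop :=
  forall ρ : form -> bool, bivaluation_LETKp ρ ->
    (forall B, In form Γ B -> ρ B = true) -> ρ A = true.

(* Main.v *)
Require Import Defs.
From Stdlib Require Import Ensembles Bool Lia Cantor Classical ClassicalEpsilon.

(** Soundness is an induction on derivations.  For completeness, a set that does
    not derive [C] extends to a set [Δ] that is maximal among those not
    deriving [C] (Lindenbaum's construction).  By maximality and the rules that
    discharge hypotheses, [Δ] is prime, so derivability from [Δ] is a
    bivaluation for LET_K^+, and it refutes [C]. *)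

(** * Soundness: every rule preserves truth under bivaluations *)

Lemma satisfies_Add (ρ : form -> bool) (Γ : Ensemble form) (A : form) :
  (forall B, In form Γ B -> ρ B = true) -> ρ A = true ->
  forall B, In form (Add form Γ A) B -> ρ B = true.
Proof. intros HΓ HA B [? HB | ? []]; auto. Qed.

Lemma rho_isT (ρ : form -> bool) (A : form) : bivaluation_LETKp ρ ->
  ρ (isT A) = true <-> ρ (∘ A) = true /\ ρ A = true.
Proof. intros Hρ. apply (v1 _ (vK _ Hρ)). Qed.

Lemma rho_isF (ρ : form -> bool) (A : form) : bivaluation_LETKp ρ ->
  ρ (isF A) = true <-> ρ (∘ A) = true /\ ρ (¬ A) = true.
Proof. intros Hρ. apply (v1 _ (vK _ Hρ)). Qed.

Ltac solve_bivaluation ρ Hρ A B :=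
  rewrite ?rho_isT, ?rho_isF by exact Hρ;
  rewrite ?(v1 _ (vK _ Hρ)), ?(v2 _ (vK _ Hρ)), ?(v3 _ (vK _ Hρ)),
    ?(v5 _ (vK _ Hρ)), ?(v6 _ (vK _ Hρ)), ?(v7 _ (vK _ Hρ));
  pose proof (v8 _ (vK _ Hρ) A); pose proof (v8 _ (vK _ Hρ) B);
  destruct (ρ A), (ρ B); intuition congruence.

(** This and the next five equivalences repackage clauses [vp3] to [vp17] in the shape of the rules
    for [isT] and [isF], so that soundness of those rules reduces to rewriting and propositional
    reasoning. *)
Lemma rho_isT_And (ρ : form -> bool) (A B : form) : bivaluation_LETKp ρ ->
  ρ (isT (A ∧ B)) = true <-> ρ (isT A) = true /\ ρ (isT B) = true.
Proof.
  intros Hρ. pose proof (vp3 _ Hρ A B). pose proof (vp6 _ Hρ A B).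
  solve_bivaluation ρ Hρ A B.
Qed.

Lemma rho_isF_And (ρ : form -> bool) (A B : form) : bivaluation_LETKp ρ ->
  ρ (isF (A ∧ B)) = true <-> ρ (isF A) = true \/ ρ (isF B) = true.
Proof.
  intros Hρ. pose proof (vp4 _ Hρ A B). pose proof (vp5 _ Hρ A B).
  pose proof (vp7 _ Hρ A B).
  solve_bivaluation ρ Hρ A B.
Qed.

Lemma rho_isT_Or (ρ : form -> bool) (A B : form) : bivaluation_LETKp ρ ->
  ρ (isT (A ∨ B)) = true <-> ρ (isT A) = true \/ ρ (isT B) = true.
Proof.
  intros Hρ. pose proof (vp8 _ Hρ A B). pose proof (vp9 _ Hρ A B).
  pose proof (vp11 _ Hρ A B).
  solve_bivaluation ρ Hρ A B.
Qed.

Lemma rho_isF_Or (ρ : form -> bool) (A B : form) : bivaluation_LETKp ρ ->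
  ρ (isF (A ∨ B)) = true <-> ρ (isF A) = true /\ ρ (isF B) = true.
Proof.
  intros Hρ. pose proof (vp10 _ Hρ A B). pose proof (vp12 _ Hρ A B).
  (* [vp12] asks for [A] and [B] to be false, which [v8] at [A] or [B] cannot give before [∘ A] or
     [∘ B] is known; [v8] at the disjunction gives it. *)
  pose proof (v8 _ (vK _ Hρ) (A ∨ B)) as Hor.
  rewrite <- not_true_iff_false, (v2 _ (vK _ Hρ)), (v6 _ (vK _ Hρ)) in Hor.
  solve_bivaluation ρ Hρ A B.
Qed.

Lemma rho_isT_Imp (ρ : form -> bool) (A B : form) : bivaluation_LETKp ρ ->
  ρ (isT (A → B)) = true <-> ρ (isF A) = true \/ ρ (isT B) = true.
Proof.
  intros Hρ. pose proof (vp13 _ Hρ A B). pose proof (vp14 _ Hρ A B).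
  pose proof (vp16 _ Hρ A B).
  solve_bivaluation ρ Hρ A B.
Qed.

Lemma rho_isF_Imp (ρ : form -> bool) (A B : form) : bivaluation_LETKp ρ ->
  ρ (isF (A → B)) = true <-> ρ A = true /\ ρ (isF B) = true.
Proof.
  intros Hρ. pose proof (vp15 _ Hρ A B). pose proof (vp17 _ Hρ A B).
  solve_bivaluation ρ Hρ A B.
Qed.

Lemma soundness (Γ : Ensemble form) (A : form) :
  LETKp Γ A -> entails_LETKp Γ A.
Proof.
  intros H; induction H; intros ρ Hρ HΓ;
    pose proof (vK _ Hρ) as HK;
    (* A premise with a discharged hypothesis [X] becomes an implication from [ρ X = true]. *)
    repeat match goal with
      | IH : entails_LETKp (Add form Γ ?X) _ |- _ =>
          pose proof (fun HX => IH ρ Hρ (satisfies_Add ρ Γ X HΓ HX)); clear IH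
      | IH : entails_LETKp Γ _ |- _ => specialize (IH ρ Hρ HΓ)
      end;
    rewrite ?rho_isT_And, ?rho_isF_And, ?rho_isT_Or, ?rho_isF_Or, ?rho_isT_Imp,
      ?rho_isF_Imp in * by exact Hρ;
    try pose proof (v8 _ HK A);
    rewrite ?(v1 _ HK), ?(v2 _ HK), ?(v3 _ HK), ?(v4 _ HK), ?(v5 _ HK),
      ?(v6 _ HK), ?(v7 _ HK), ?(vp1 _ Hρ), ?(vp2 _ Hρ) in *;
    solve [auto | try destruct (ρ A); intuition congruence].
Qed.

(** * Compactness and weakening *)

Definition eventually (P : nat -> Prop) : Prop :=
  exists n, forall m, n <= m -> P m.

Lemma eventually_and (P Q : nat -> Prop) :
  eventually P -> eventually Q -> eventually (fun n => P n /\ Q n).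
Proof.
  intros [n Hn] [k Hk]. exists (n + k). intros m Hm.
  split; [apply Hn | apply Hk]; lia.
Qed.

Lemma eventually_impl (P Q : nat -> Prop) :
  (forall n, P n -> Q n) -> eventually P -> eventually Q.
Proof. intros HPQ [n Hn]. exists n. auto. Qed.

(* Compactness along a sequence of sets; constant sequences give weakening.
   Concluding "eventually" rather than "at some stage" lets the induction
   combine premises without appealing to weakening. *)
Lemma LETKp_eventually (Γ : Ensemble form) (A : form) : LETKp Γ A ->
  forall G : nat -> Ensemble form,
  (forall B, In form Γ B -> eventually (fun n => In form (G n) B)) ->
  eventually (fun n => LETKp (G n) A).
Proof.
  (* For a rule that discharges [X], the induction hypothesis is used on the sequence with [X] added
     at every stage. *)
  assert (Hadd : forall (Γ : Ensemble form) (X : form) (G : nat -> Ensemble form),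
    (forall B, In form Γ B -> eventually (fun n => In form (G n) B)) ->
    forall B, In form (Add form Γ X) B ->
    eventually (fun n => In form (Add form (G n) X) B)).
  { intros Θ X G HG B [? HB | ? []].
    - apply (eventually_impl (fun n => In form (G n) x)); [|auto].
      intros n Hn. now left.
    - exists 0. intros m _. right. constructor. }
  intros H; induction H; intros G HG.
  1: { eapply eventually_impl; [|apply (HG _ H)]. intros n. apply (Hyp (G n)). }
  all: repeat match goal with
    | IH : forall G', (forall B, In form (Add form ?Γ ?X) B -> _) -> _ |- _ =>
        specialize (IH (fun n => Add form (G n) X) (Hadd _ X G HG))
    | IH : forall G', (forall B, In form ?Γ B -> _) -> _ |- _ =>
        specialize (IH G HG)
    end.
  (* Finitely many premises are derivable from a common stage on. *)
  all: repeat match goal with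
    | H1 : eventually _, H2 : eventually _ |- _ =>
        pose proof (eventually_and _ _ H1 H2); clear H1 H2
    end.
  all: try match goal with
    | H : eventually _ |- _ => revert H; apply eventually_impl; cbv beta
    end.
  all: try solve [exists 0; intros; constructor].
  all: intros n Hn.
  all: repeat match goal with H : _ /\ _ |- _ => destruct H end.
  all: solve [econstructor; eassumption].
Qed.

Lemma weakening (Γ Δ : Ensemble form) (A : form) :
  Included form Γ Δ -> LETKp Γ A -> LETKp Δ A.
Proof.
  intros Hsub H. destruct (LETKp_eventually Γ A H (fun _ => Δ)) as [n Hn].
  - intros B HB. exists 0. intros _ _. now apply Hsub.
  - exact (Hn n (le_n n)).
Qed.

(** * Lindenbaum's construction along an injective numbering of formulas *)

Fixpoint code (A : form) : nat :=
  match A with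
  | Var n => to_nat (0, n)
  | And A B => to_nat (1, to_nat (code A, code B))
  | Or A B => to_nat (2, to_nat (code A, code B))
  | Imp A B => to_nat (3, to_nat (code A, code B))
  | Neg A => to_nat (4, code A)
  | Circ A => to_nat (5, code A)
  end.

Lemma code_inj (A B : form) : code A = code B -> A = B.
Proof.
  revert B.
  induction A; intros [] H; cbn [code] in H;
    apply to_nat_inj, pair_equal_spec in H as [Htag H]; try discriminate Htag;
    try apply to_nat_inj, pair_equal_spec in H as [H H'];
    f_equal; auto.
Qed.

(** The formula with code [n], if there is one, is examined between stages [n] and [S n]. Stages are
    predicates, so neither a decoding function nor a decision of derivability is required. *)
Fixpoint lindenbaum (Γ : Ensemble form) (C : form) (n : nat) : Ensemble form :=
  match n with
  | 0 => Γ
  | S n => fun B => In form (lindenbaum Γ C n) B \/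
      (code B = n /\ ~ LETKp (Add form (lindenbaum Γ C n) B) C)
  end.

Lemma lindenbaum_incl (Γ : Ensemble form) (C : form) (n m : nat) :
  n <= m -> Included form (lindenbaum Γ C n) (lindenbaum Γ C m).
Proof.
  induction 1 as [|m _ IH]; intros B HB; [exact HB|].
  left. exact (IH B HB).
Qed.

Lemma lindenbaum_not_derives (Γ : Ensemble form) (C : form) (n : nat) :
  ~ LETKp Γ C -> ~ LETKp (lindenbaum Γ C n) C.
Proof.
  intros HΓ; induction n as [|n IH]; [exact HΓ|]. intros H.
  (* Injectivity of [code] means that at most one formula enters; if none does, the stage is
     unchanged. *)
  destruct (classic (exists B, code B = n /\
    ~ LETKp (Add form (lindenbaum Γ C n) B) C)) as [[B [HB HnB]]|Hno].
  - apply HnB. revert H. apply weakening. intros D [HD | [HD _]].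
    + now left.
    + right. rewrite (code_inj D B) by congruence. constructor.
  - apply IH. revert H. apply weakening. intros D [HD | HD]; [exact HD|].
    exfalso. eauto.
Qed.

(** Maximality is phrased with derivability of [B] instead of membership, so deductive closure of
    [Δ] need not be proved. *)
Definition saturated (Δ : Ensemble form) (C : form) : Prop :=
  ~ LETKp Δ C /\ forall B, LETKp Δ B \/ LETKp (Add form Δ B) C.

Lemma saturated_extension (Γ : Ensemble form) (C : form) :
  ~ LETKp Γ C -> exists Δ, Included form Γ Δ /\ saturated Δ C.
Proof.
  intros HΓ.
  exists (fun B => exists n, In form (lindenbaum Γ C n) B). split; [|split].
  - intros B HB. now exists 0.
  - intros H. destruct (LETKp_eventually _ _ H (lindenbaum Γ C)) as [n Hn].
    + intros B [n Hn]. exists n. intros m Hm.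
      exact (lindenbaum_incl Γ C n m Hm B Hn).
    + exact (lindenbaum_not_derives Γ C n HΓ (Hn n (le_n n))).
  - intros B.
    (* This is the very test that decides whether [B] enters at stage [S (code B)]. *)
    destruct (classic (LETKp (Add form (lindenbaum Γ C (code B)) B) C))
      as [H | H].
    + right. revert H. apply weakening. intros D [D' HD | D' HD].
      * left. now exists (code B).
      * now right.
    + left. apply Hyp. exists (S (code B)). now right.
Qed.

(** * Derivability from a saturated set is a bivaluation *)

(** The second hypothesis is an elimination rule with two discharged cases, its major premise
    derived and its conclusion taken to be [C]. If neither case formula were derivable, saturation
    would make both cases derive [C]. *)
Lemma saturated_cases (Δ : Ensemble form) (C A B : form) : saturated Δ C ->
  (LETKp (Add form Δ A) C -> LETKp (Add form Δ B) C -> LETKp Δ C) ->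
  LETKp Δ A \/ LETKp Δ B.
Proof.
  intros [HC Hsat] Hcase.
  destruct (Hsat A) as [HA | HA]; [now left|].
  destruct (Hsat B) as [HB | HB]; [now right|].
  exfalso. auto.
Qed.

Lemma LETKp_isT (Γ : Ensemble form) (A : form) :
  LETKp Γ (isT A) <-> LETKp Γ (∘ A) /\ LETKp Γ A.
Proof.
  split; [intros H; split | intros [? ?]; now apply AndI].
  - exact (AndE1 _ _ _ H).
  - exact (AndE2 _ _ _ H).
Qed.

Lemma LETKp_isF (Γ : Ensemble form) (A : form) :
  LETKp Γ (isF A) <-> LETKp Γ (∘ A) /\ LETKp Γ (¬ A).
Proof.
  split; [intros H; split | intros [? ?]; now apply AndI].
  - exact (AndE1 _ _ _ H).
  - exact (AndE2 _ _ _ H).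
Qed.

Lemma saturated_or (Δ : Ensemble form) (C A B : form) : saturated Δ C ->
  LETKp Δ (A ∨ B) <-> LETKp Δ A \/ LETKp Δ B.
Proof.
  intros Hsat. split.
  - intros H. apply (saturated_cases Δ C A B Hsat). exact (OrE _ _ _ _ H).
  - intros [H | H]; [now apply OrI1 | now apply OrI2].
Qed.

(** When [A] is not derivable, primeness applied to the axiom [ImpCL] leaves only [A → B]. *)
Lemma saturated_imp (Δ : Ensemble form) (C A B : form) : saturated Δ C ->
  LETKp Δ (A → B) <-> ~ LETKp Δ A \/ LETKp Δ B.
Proof.
  intros Hsat. split.
  - intros H. destruct (classic (LETKp Δ A)) as [HA | HA]; [right | now left].
    exact (ImpE _ _ _ H HA).
  - intros [H | H].
    + destruct (proj1 (saturated_or Δ C A (A → B) Hsat) (ImpCL Δ A B));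
        [contradiction | assumption].
    + apply ImpI. revert H. apply weakening. intros D HD. now left.
Qed.

(** [EXPCirc] with conclusion [C] excludes deriving both [A] and [¬ A]; [PEMCirc] with primeness
    yields one of them. *)
Lemma saturated_neg (Δ : Ensemble form) (C A : form) : saturated Δ C ->
  LETKp Δ (∘ A) -> LETKp Δ (¬ A) <-> ~ LETKp Δ A.
Proof.
  intros Hsat Hcirc. split.
  - intros HN HA. exact (proj1 Hsat (EXPCirc _ _ C Hcirc HA HN)).
  - intros HA.
    now destruct (proj1 (saturated_or Δ C _ _ Hsat) (PEMCirc Δ A Hcirc)).
Qed.

Lemma saturated_bivaluation (Δ : Ensemble form) (C : form) (ρ : form -> bool) :
  saturated Δ C -> (forall B, ρ B = true <-> LETKp Δ B) -> bivaluation_LETKp ρ.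
Proof.
  intros Hsat Hρ.
  assert (Hρ0 : forall B, ρ B = false <-> ~ LETKp Δ B).
  { intros B. now rewrite <- Hρ, not_true_iff_false. }
  (* Truth values become derivability statements, and pairs [∘ A], [A] or [∘ A], [¬ A] are folded
     into [isT A] or [isF A] to fit the rules. *)
  constructor; [constructor|..]; intros A; intros;
    rewrite ?Hρ0, ?Hρ in *; rewrite <- ?LETKp_isT, <- ?LETKp_isF in *.
  - split; [intros H0; split | intros [? ?]; now apply AndI].
    + exact (AndE1 _ _ _ H0).
    + exact (AndE2 _ _ _ H0).
  - exact (saturated_or Δ C A B Hsat).
  - exact (saturated_imp Δ C A B Hsat).
  - split; [apply DNE | apply DNI].
  - split.
    + intros H0. apply (saturated_cases Δ C _ _ Hsat).
      exact (NegAndE _ _ _ _ H0).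
    + intros [? | ?]; [now apply NegAndI1 | now apply NegAndI2].
  - split; [intros H0; split | intros [? ?]; now apply NegOrI].
    + exact (NegOrE1 _ _ _ H0).
    + exact (NegOrE2 _ _ _ H0).
  - split; [intros H0; split | intros [? ?]; now apply NegImpI].
    + exact (NegImpE1 _ _ _ H0).
    + exact (NegImpE2 _ _ _ H0).
  - now apply (saturated_neg Δ C).
  - apply ICirc.
  - apply eq_true_iff_eq. rewrite !Hρ. split; [apply ENegCirc | apply INegCirc].
  - exact (AndE1 _ _ _ (IAndT _ _ _ H H0)).
  - exact (AndE1 _ _ _ (IAndF1 _ _ _ H)).
  - exact (AndE1 _ _ _ (IAndF2 _ _ _ H)).
  - destruct H as [Hc [HA HB]].
    assert (HT : LETKp Δ (isT (A ∧ B)))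
      by (apply LETKp_isT; split; [|apply AndI]; assumption).
    split.
    + exact (AndE1 _ _ _ (EAndT1 _ _ _ HT)).
    + exact (AndE1 _ _ _ (EAndT2 _ _ _ HT)).
  - apply (saturated_cases Δ C _ _ Hsat), EAndF, LETKp_isF. split; [assumption|].
    destruct H0; [now apply NegAndI1 | now apply NegAndI2].
  - exact (AndE1 _ _ _ (IOrT1 _ _ _ H)).
  - exact (AndE1 _ _ _ (IOrT2 _ _ _ H)).
  - exact (AndE1 _ _ _ (IOrF _ _ _ H H0)).
  - apply (saturated_cases Δ C _ _ Hsat), EOrT, LETKp_isT. split; [assumption|].
    now apply (saturated_or Δ C).
  (* By primeness the disjunction is not derivable, so [∘ (A ∨ B)] makes its negation derivable. *)
  - assert (HF : LETKp Δ (isF (A ∨ B))).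
    { apply LETKp_isF. split; [assumption|]. apply (saturated_neg Δ C); auto.
      rewrite (saturated_or Δ C) by exact Hsat. tauto. }
    split.
    + exact (AndE1 _ _ _ (EOrF1 _ _ _ HF)).
    + exact (AndE1 _ _ _ (EOrF2 _ _ _ HF)).
  - exact (AndE1 _ _ _ (IImpT1 _ _ _ H)).
  - exact (AndE1 _ _ _ (IImpT2 _ _ _ H)).
  - exact (AndE1 _ _ _ (IImpF _ _ _ H H0)).
  - apply (saturated_cases Δ C _ _ Hsat), EImpT, LETKp_isT. split; [assumption|].
    now apply (saturated_imp Δ C).
  - destruct H0 as [HA HB]. apply (AndE1 Δ _ (¬ B)), (EImpF2 Δ A B), LETKp_isF.
    split; [assumption | now apply NegImpI].
Qed.

Theorem theorem3p7 (Γ : Ensemble form) (A : form) :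
  LETKp Γ A <-> entails_LETKp Γ A.
Proof.
  split; [apply soundness|]. intros H. apply NNPP. intros HA.
  destruct (saturated_extension Γ A HA) as [Δ [HΓ Hsat]].
  (* Informative excluded middle turns the proposition of derivability into a Boolean value. *)
  set (ρ := fun B =>
    if excluded_middle_informative (LETKp Δ B) then true else false).
  assert (Hρ : forall B, ρ B = true <-> LETKp Δ B).
  { intros B. unfold ρ.
    destruct (excluded_middle_informative (LETKp Δ B)); easy. }
  apply (proj1 Hsat). apply Hρ. apply H.
  - exact (saturated_bivaluation Δ A ρ Hsat Hρ).
  - intros B HB. apply Hρ, Hyp, HΓ, HB.
Qed.
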